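(* Let $\mathcal S$ be a semigroup of real $d\times d$ matrices, and let a basis of $\mathbb R^d$ be chosen in which all $A\in\mathcal S$ have the block upper triangular form $$A=\begin{pmatrix}A^{(1)} & * & \cdots & *\\ 0 & A^{(2)} & * & \vdots\\ \vdots & & \ddots & *\\ 0&\cdots&0&A^{(s)}\end{pmatrix}$$ with square diagonal blocks whose locations and sizes $d^{(1)},\dots,d^{(s)}$ ($\sum_i d^{(i)}=d$) do not depend on $A\in\mathcal S$, and such that for each $i$ the semigroup $\mathcal S^{(i)}=\{A^{(i)} : A\in\mathcal S\}$ of $d^{(i)}\times d^{(i)}$ matrices is irreducible. Then $\mathcal S$ is c.s.r. if and only if there is an index $j\in\{1,\dots,s\}$ such that $\mathcal S^{(j)}$ is c.s.r. and $\rho(\mathcal S^{(i)})\le 1$ for all $i\ne j$.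
   Context: Matrix semigroups are multiplicative; the paper considers semigroups $\mathcal S$ that are topologically closed. The spectral radius $\rho(A)$ of a matrix is the maximal modulus of its eigenvalues. A matrix semigroup is c.s.r. (has constant spectral radius) if the spectral radius of all its elements is the same and nonzero (this common value is then $1$). A family of $d\times d$ matrices is irreducible if there is no proper linear subspace of $\mathbb R^d$ (i.e. different from $\{0\}$ and $\mathbb R^d$) invariant for all matrices of the family. A basis giving the block form in the claim always exists; if $\mathcal S$ is irreducible, then $s=1$, $d^{(1)}=d$, $\mathcal S^{(1)}=\mathcal S$. The joint spectral radius of a bounded family of matrices $\mathcal M$ is $\rho(\mathcal M)=\lim_{k\to\infty}\sup\{\|M_k\cdots M_1\|^{1/k} : M_1,\dots,M_k\in\mathcal M\}$ (independent of the matrix norm); the condition $\rho(\mathcal S^{(i)})\le1$ includes that $\mathcal S^{(i)}$ is bounded. *)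

(* Defs.v *)
From HB Require Import structures.
From mathcomp Require Import all_boot all_order all_algebra.
From mathcomp Require Import all_classical all_reals all_analysis.
From mathcomp Require Import complex.

Set Implicit Arguments.
Unset Strict Implicit.
Unset Printing Implicit Defensive.

Import Order.TTheory GRing.Theory Num.Theory.
Import numFieldNormedType.Exports.

Local Open Scope classical_set_scope.
Local Open Scope ring_scope.

Definition mx_semigroup (R : realType) (n : nat) (S : set 'M[R]_n) : Prop :=
  forall A B, S A -> S B -> S (A *m B).

(* The eigenvalues of the real matrix A are taken in R[i]; they form a finite
   set, nonempty if 0 < n, so this supremum is a maximum. *)
Definition spectral_radius (R : realType) (n : nat) (A : 'M[R]_n) : R :=
  sup [set Normc.normc l | l in
        [set l : R[i] | eigenvalue (map_mx (real_complex R) A) l]].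

Definition csr (R : realType) (n : nat) (S : set 'M[R]_n) : Prop :=
  exists2 r : R, r != 0 & forall A, S A -> spectral_radius A = r.

Definition irreducible_mxset (R : realType) (n : nat) (S : set 'M[R]_n) : Prop :=
  forall V : {vspace 'cV[R]_n},
    (forall A, S A -> forall v, v \in V -> A *m v \in V) ->
    V = 0%VS \/ V = fullv.

(* Here `| _ | is the entrywise maximum norm; all norms give the same limit.
   The order of the k factors does not matter, as M ranges over all k-tuples.
   Meaningful for bounded S only: sup is 0 on sets that are unbounded above. *)
Definition joint_spectral_radius (R : realType) (n : nat) (S : set 'M[R]_n) : R :=
  limn (fun k : nat =>
    sup [set `| \prod_(i < k) M i | `^ (k%:R^-1) | M in
          [set M : 'I_k -> 'M[R]_n | forall i, S (M i)]]).

(* The columns of P are the chosen basis. *)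
Definition in_basis (R : realType) (n : nat) (P A : 'M[R]_n) : 'M[R]_n :=
  invmx P *m A *m P.

Definition block_upper_triangular (R : realType) (s : nat) (d : 'I_s -> nat)
    (A : 'M[R]_(\sum_(i < s) d i)) : Prop :=
  forall i j : 'I_s, (j < i)%N -> submxblock A i j = 0.

Definition diag_block_set (R : realType) (s : nat) (d : 'I_s -> nat)
    (P : 'M[R]_(\sum_(i < s) d i)) (S : set 'M[R]_(\sum_(i < s) d i))
    (i : 'I_s) : set 'M[R]_(d i) :=
  [set submxblock (in_basis P A) i i | A in S].
Arguments diag_block_set {R s d} P S i _.

(* Main.v *)
Require Import Defs.
From HB Require Import structures.
From mathcomp Require Import all_boot all_order all_algebra.
From mathcomp Require Import all_classical all_reals all_analysis.
From mathcomp Require Import complex ring lra.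

Set Implicit Arguments.
Unset Strict Implicit.
Unset Printing Implicit Defensive.

Import Order.TTheory GRing.Theory Num.Theory.
Import numFieldNormedType.Exports.

Local Open Scope classical_set_scope.
Local Open Scope ring_scope.

(** The spectrum of a block triangular matrix is the union of the spectra of its
diagonal blocks, so everything is about the semigroups of diagonal blocks. The
key fact is that an irreducible semigroup whose elements have spectral radius at
most [1] is bounded: the trace form is nondegenerate on its linear span, and the
traces [\tr (A *m B)] of elements of the semigroup are bounded by the dimension.
A bounded semigroup has spectral radii and joint spectral radius at most [1].
Hence, if the semigroup is c.s.r., all blocks are bounded semigroups; if none of
them were c.s.r., then for each [j] some [A_j] would have a [j]-th block of
spectral radius less than [1], and in a product of high powers of the [A_j] all
diagonal blocks would be small, contradicting that its spectral radius is [1]. *)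

(** * Entrywise norm and powers of matrices *)

(** Submultiplicative, unlike the maximum norm, and defined over any [numDomainType], so that it
    serves real matrices and their complexifications alike. *)
Definition entry_norm (K : numDomainType) m n (A : 'M[K]_(m, n)) : K :=
  \sum_i \sum_j `|A i j|.

Lemma entry_norm_ge0 (K : numDomainType) m n (A : 'M[K]_(m, n)) :
  0 <= entry_norm A.
Proof. by apply: sumr_ge0 => i _; apply: sumr_ge0. Qed.

Lemma le_entry_norm (K : numDomainType) m n (A : 'M[K]_(m, n)) i j :
  `|A i j| <= entry_norm A.
Proof.
rewrite /entry_norm (bigD1 i)//= (bigD1 j)//= -addrA lerDl addr_ge0//.
  by apply: sumr_ge0.
by apply: sumr_ge0 => ? _; apply: sumr_ge0.
Qed.

Lemma entry_norm_eq0 (K : numDomainType) m n (A : 'M[K]_(m, n)) :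
  (entry_norm A == 0) = (A == 0).
Proof.
apply/eqP/eqP => [A0|->]; last first.
  by rewrite /entry_norm big1// => i _; rewrite big1// => j _; rewrite mxE normr0.
apply/matrixP => i j; rewrite mxE; apply/eqP; rewrite -normr_le0 -A0.
exact: le_entry_norm.
Qed.

Lemma entry_normD (K : numDomainType) m n (A B : 'M[K]_(m, n)) :
  entry_norm (A + B) <= entry_norm A + entry_norm B.
Proof.
rewrite /entry_norm -big_split/=; apply: ler_sum => i _.
by rewrite -big_split/=; apply: ler_sum => j _; rewrite mxE ler_normD.
Qed.

Lemma entry_normZ (K : numDomainType) m n (a : K) (A : 'M[K]_(m, n)) :
  entry_norm (a *: A) = `|a| * entry_norm A.
Proof.
rewrite /entry_norm mulr_sumr; apply: eq_bigr => i _.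
by rewrite mulr_sumr; apply: eq_bigr => j _; rewrite mxE normrM.
Qed.

Lemma entry_normM (K : numDomainType) m n p (A : 'M[K]_(m, n)) (B : 'M[K]_(n, p)) :
  entry_norm (A *m B) <= entry_norm A * entry_norm B.
Proof.
rewrite /entry_norm mulr_suml; apply: ler_sum => i _.
apply: (@le_trans _ _ (\sum_k \sum_j `|A i j| * `|B j k|)).
  apply: ler_sum => k _; rewrite mxE; apply: le_trans (ler_norm_sum _ _ _) _.
  by apply: ler_sum => j _; rewrite normrM.
rewrite exchange_big/= mulr_suml; apply: ler_sum => j _.
rewrite -mulr_sumr ler_wpM2l// (bigD1 j)//= lerDl.
by apply: sumr_ge0 => ? _; apply: sumr_ge0.
Qed.

Lemma entry_norm_sum (K : numDomainType) (I : finType) m n (F : I -> 'M[K]_(m, n)) :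
  entry_norm (\sum_i F i) <= \sum_i entry_norm (F i).
Proof.
elim/big_ind2: _ => [|A a B b hA hB|//].
  by rewrite le_eqVlt entry_norm_eq0 eqxx.
by apply: le_trans (entry_normD _ _) _; apply: lerD.
Qed.

(** * Eigenvalues, traces and summability of powers *)

Lemma eigenvalueX (F : fieldType) n (A : 'M[F]_n) (l : F) k :
  eigenvalue A l -> eigenvalue (A ^+ k) (l ^+ k).
Proof.
move=> /eigenvalueP[v vA v0]; apply/eigenvalueP; exists v => //.
elim: k => [|k IH]; first by rewrite !expr0 mulmx1 scale1r.
by rewrite !exprSr [_ * A]/GRing.mul/= mulmxA IH -scalemxAl vA scalerA.
Qed.

Lemma eigenvalue_le_entry_norm (K : numFieldType) n (A : 'M[K]_n) (l : K) :
  eigenvalue A l -> `|l| <= entry_norm A.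
Proof.
move=> /eigenvalueP[v vA v0].
have v_gt0 : 0 < entry_norm v by rewrite lt_def entry_norm_eq0 v0 entry_norm_ge0.
rewrite -(ler_pM2r v_gt0) -entry_normZ -vA mulrC; exact: entry_normM.
Qed.

Lemma char_poly_split (K : closedFieldType) n (A : 'M[K]_n) :
  exists2 s : seq K, size s = n & char_poly A = \prod_(z <- s) ('X - z%:P).
Proof.
have [s cA] := closed_field_poly_normal (char_poly A).
move: cA; rewrite (monicP (char_poly_monic A)) scale1r => cA; exists s => //.
by have := size_char_poly A; rewrite cA size_prod_XsubC => -[].
Qed.

Lemma trace_sum_eigenvalues (K : closedFieldType) n (A : 'M[K]_n) :
  exists s : seq K, [/\ size s = n, (forall z, z \in s -> eigenvalue A z) &
                     \tr A = \sum_(z <- s) z].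
Proof.
have [s sn cA] := char_poly_split A; exists s; split=> //.
  by move=> z zs; rewrite eigenvalue_root_char cA root_prod_XsubC.
case: n => [|n] in A sn cA *.
  by move/size0nil: sn => ->; rewrite big_nil /mxtrace big_ord0.
have := @coefPn_prod_XsubC _ s; rewrite sn -cA char_poly_trace//.
by move=> /(_ isT)/oppr_inj.
Qed.

(* [A ^+ k.+1 *m X = z *: (A ^+ k *m X) + A ^+ k *m ((A - z%:M) *m X)], so when the
   norms of [A ^+ k *m ((A - z%:M) *m X)] are summable, [`|z| < 1] makes those of
   [A ^+ k *m X] summable. *)
Lemma power_sums_bounded (K : numFieldType) n (A X : 'M[K]_n) (s : seq K) :
    (forall z, z \in s -> `|z| < 1) ->
    foldl (fun Y z => (A - z%:M) *m Y) X s = 0 ->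
  exists C, forall k, \sum_(i < k) entry_norm (A ^+ i *m X) <= C.
Proof.
elim: s X => [|z s IH] X /= s1 sX.
  exists 0 => k; rewrite big1// => i _; rewrite sX mulmx0.
  by apply/eqP; rewrite entry_norm_eq0.
have [||C hC] := IH ((A - z%:M) *m X).
- by move=> y ys; apply: s1; rewrite inE ys orbT.
- exact: sX.
have z1 : 0 < 1 - `|z| by rewrite subr_gt0 s1// mem_head.
(* The partial sums $t_k$ satisfy $t_k \le t_{k+1} \le |X| + C + |z| t_k$; solving for $t_k$ gives
   this constant. *)
exists ((entry_norm X + C) / (1 - `|z|)) => k.
rewrite ler_pdivlMr// mulrBr mulr1 lerBlDr.
apply: (@le_trans _ _ (\sum_(i < k.+1) entry_norm (A ^+ i *m X))).
  by rewrite big_ord_recr/= lerDl entry_norm_ge0.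
rewrite big_ord_recl expr0 mul1mx -addrA lerD2l mulrC mulr_sumr.
apply: (@le_trans _ _ (\sum_(i < k) (entry_norm (A ^+ i *m ((A - z%:M) *m X)) +
   `|z| * entry_norm (A ^+ i *m X)))); last first.
  by rewrite big_split/= lerD2r hC.
apply: ler_sum => i _; rewrite -entry_normZ.
suff -> : A ^+ bump 0 i *m X = A ^+ i *m ((A - z%:M) *m X) + z *: (A ^+ i *m X).
  exact: entry_normD.
rewrite /bump leq0n add1n exprSr [_ * A]/GRing.mul/= mulmxBl mulmxBr mul_scalar_mx.
by rewrite -scalemxAr subrK mulmxA.
Qed.

(** Cayley-Hamilton, with the linear factors applied one at a time to match the induction of
    [power_sums_bounded]. *)
Lemma foldl_char_poly_eq0 (K : closedFieldType) n (A : 'M[K]_n) (s : seq K) :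
  char_poly A = \prod_(z <- s) ('X - z%:P) ->
  foldl (fun Y z => (A - z%:M) *m Y) 1%:M s = 0.
Proof.
case: n A => [|n] A cA; first by apply/matrixP => -[].
have E X : foldl (fun Y z => (A - z%:M) *m Y) X s =
    horner_mx A (\prod_(z <- s) ('X - z%:P)) *m X.
  elim: s X {cA} => [|z s IH] X /=; first by rewrite big_nil rmorph1 mul1mx.
  rewrite IH big_cons mulrC rmorphM rmorphB/= horner_mx_X horner_mx_C.
  by rewrite -[in RHS]mulmxE mulmxA.
by rewrite E -cA Cayley_Hamilton mul0mx.
Qed.

Lemma bounded_power_sums (K : numClosedFieldType) n (A : 'M[K]_n) :
  (forall l, eigenvalue A l -> `|l| < 1) ->
  exists C, forall k, \sum_(i < k) entry_norm (A ^+ i) <= C.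
Proof.
move=> A1; have [s _ cA] := char_poly_split A.
have [|C hC] := @power_sums_bounded _ _ A 1%:M s _ (foldl_char_poly_eq0 cA).
  by move=> z zs; apply: A1; rewrite eigenvalue_root_char cA root_prod_XsubC.
by exists C => k; under eq_bigr => i _ do rewrite -[A ^+ i]mulmx1; exact: hC.
Qed.

(** * Spectral radius *)

Local Notation complex_mx R := (map_mx (real_complex R)).

Lemma normc_real (R : realType) (x : R) : Normc.normc (real_complex R x) = `|x|.
Proof. by rewrite /= expr0n/= addr0 sqrtr_sqr. Qed.

Lemma norm_normc (R : realType) (z : R[i]) : `|z| = real_complex R (Normc.normc z).
Proof. by []. Qed.

Lemma entry_norm_complex (R : realType) m n (A : 'M[R]_(m, n)) :
  entry_norm (complex_mx R A) = real_complex R (entry_norm A).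
Proof.
rewrite /entry_norm rmorph_sum; apply: eq_bigr => i _.
rewrite rmorph_sum; apply: eq_bigr => j _.
by rewrite mxE norm_normc normc_real.
Qed.

Lemma normc_eigenvalue_le (R : realType) n (A : 'M[R]_n) (l : R[i]) :
  eigenvalue (complex_mx R A) l -> Normc.normc l <= entry_norm A.
Proof.
move=> /eigenvalue_le_entry_norm; rewrite entry_norm_complex norm_normc.
by rewrite lecR.
Qed.

Lemma spectral_radius_ub (R : realType) n (A : 'M[R]_n) (l : R[i]) :
  eigenvalue (complex_mx R A) l -> Normc.normc l <= spectral_radius A.
Proof.
move=> Al; apply: ub_le_sup; last by exists l.
by exists (entry_norm A) => _ [z Az <-]; exact: normc_eigenvalue_le.
Qed.

Lemma spectral_radius_le (R : realType) n (A : 'M[R]_n) (r : R) : (0 < n)%N ->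
  (forall l, eigenvalue (complex_mx R A) l -> Normc.normc l <= r) ->
  spectral_radius A <= r.
Proof.
move=> n0 Ar; apply: ge_sup; last by move=> _ [z Az <-]; exact: Ar.
have [l Al] := eigenvalue_closed (complex_mx R A) n0.
by exists (Normc.normc l), l.
Qed.

Lemma spectral_radius_le_entry_norm (R : realType) n (A : 'M[R]_n) : (0 < n)%N ->
  spectral_radius A <= entry_norm A.
Proof. by move=> n0; apply: spectral_radius_le => // l; exact: normc_eigenvalue_le. Qed.

Lemma normc_ge0 (R : realType) (z : R[i]) : 0 <= Normc.normc z.
Proof. by case: z => a b; exact: sqrtr_ge0. Qed.

Lemma spectral_radius_ge0 (R : realType) n (A : 'M[R]_n) : (0 < n)%N ->
  0 <= spectral_radius A.
Proof.
move=> n0; have [l Al] := eigenvalue_closed (complex_mx R A) n0.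
exact: le_trans (normc_ge0 l) (spectral_radius_ub Al).
Qed.

Lemma normcX (R : realType) (z : R[i]) k : Normc.normc (z ^+ k) = Normc.normc z ^+ k.
Proof.
elim: k => [|k IH]; first by rewrite !expr0 Normc.normc1.
by rewrite !exprS Normc.normcM IH.
Qed.

(** The trace is the sum of the [n] complex eigenvalues, counted with multiplicity. *)
Lemma normr_trace_le (R : realType) n (A : 'M[R]_n) (r : R) :
  spectral_radius A <= r -> `|\tr A| <= n%:R * r.
Proof.
move=> Ar; have [s [sn sA trA]] := trace_sum_eigenvalues (complex_mx R A).
rewrite -(lecR (`|\tr A|)) -normc_real -norm_normc -trace_map_mx/= trA.
apply: le_trans (ler_norm_sum _ _ _) _; rewrite -sn rmorphM rmorph_nat.
have -> : (size s)%:R * real_complex R r = \sum_(z <- s) real_complex R r.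
  by rewrite big_const_seq count_predT iter_addr_0 mulr_natl.
rewrite big_seq [leRHS]big_seq; apply: ler_sum => z zs.
by rewrite norm_normc lecR (le_trans _ Ar)// spectral_radius_ub// sA.
Qed.

(** The norms of the powers have bounded partial sums, so they cannot all stay above [e]. *)
Lemma small_power (R : realType) n (A : 'M[R]_n) (e : R) :
  spectral_radius A < 1 -> 0 < e -> exists2 k, (0 < k)%N & entry_norm (A ^+ k) < e.
Proof.
move=> A1 e0.
have [|c hC] := @bounded_power_sums _ _ (complex_mx R A).
  move=> l Al; rewrite norm_normc -[1]/(real_complex R 1) ltcR.
  exact: le_lt_trans (spectral_radius_ub Al) A1.
(* Numbers comparable in [R[i]] have equal imaginary parts, so the real part of [c] bounds the real
   sums. *)
have C k : \sum_(i < k) entry_norm (A ^+ i) <= complex.Re c.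
  have := hC k; have -> : \sum_(i < k) entry_norm (complex_mx R A ^+ i) =
    real_complex R (\sum_(i < k) entry_norm (A ^+ i)).
    rewrite rmorph_sum; apply: eq_bigr => i _.
    by rewrite -rmorphXn entry_norm_complex.
  by case: c {hC} => a b; rewrite lecE/= => /andP[].
apply: contrapT => /forall2NP noA.
have leA k : (0 < k)%N -> e <= entry_norm (A ^+ k).
  by move=> k0; have [/negP|/negP] := noA k; rewrite ?k0// -leNgt.
have := archi_boundP (normr_ge0 (complex.Re c / e)).
set N := Num.bound _; rewrite ltNge => /negP; apply.
apply: le_trans (ler_norm _); rewrite ler_pdivlMr//.
apply: le_trans (C N.+1); rewrite big_ord_recl.
apply: ler_wpDl; first exact: entry_norm_ge0.
rewrite -[N in leLHS]card_ord mulrC mulr_natr -sumr_const.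
by apply: ler_sum => i _; apply: leA.
Qed.

(** * Spectrum of block triangular matrices *)

Section BlockTriangular.
Context (F : fieldType) (s : nat) (d : 'I_s -> nat).
Local Notation D := (\sum_(i < s) d i)%N.
Implicit Types A B : 'M[F]_D.

Lemma submxblockM A B i j :
  submxblock (A *m B) i j = \sum_k submxblock A i k *m submxblock B k j.
Proof.
by rewrite -{1}(submxblockK A) -{1}(submxblockK B) mul_mxblock mxblockK.
Qed.

Lemma submxblockM_diag A B i :
    (forall i j : 'I_s, (j < i)%N -> submxblock A i j = 0) ->
    (forall i j : 'I_s, (j < i)%N -> submxblock B i j = 0) ->
  submxblock (A *m B) i i = submxblock A i i *m submxblock B i i.
Proof.
move=> hA hB; rewrite submxblockM (bigD1 i)//= big1 ?addr0// => k.
rewrite neq_ltn => /orP[ki|ik]; first by rewrite hA// mul0mx.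
by rewrite hB// mulmx0.
Qed.

Lemma submxblock_scalar (a : F) i : submxblock (a%:M : 'M[F]_D) i i = a%:M.
Proof. by apply/matrixP => k l; rewrite !mxE -val_eqE tagnat.eq_Rank eqxx. Qed.

Lemma submxblock_scalar_off (a : F) i j :
  i != j -> submxblock (a%:M : 'M[F]_D) i j = 0.
Proof.
by move=> ij; apply/matrixP => k l; rewrite !mxE -val_eqE tagnat.eq_Rank (negPf ij).
Qed.

(** The first nonzero block of a row eigenvector of [A] is a row eigenvector of the diagonal block
    at that place. *)
Lemma eigenvalue_block A l :
    (forall i j : 'I_s, (j < i)%N -> submxblock A i j = 0) ->
  eigenvalue A l -> exists i, eigenvalue (submxblock A i i) l.
Proof.
move=> hA /eigenvalueP[v vA v0].
have /existsP[i0 hi0] : [exists i, submxrow v i != 0].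
  apply: contraR v0; rewrite negb_exists => /forallP h; apply/eqP/mxrowP => j.
  by rewrite submxrow0; apply/eqP; rewrite -[_ == _]negbK.
case: (@arg_minnP _ i0 (fun i => submxrow v i != 0) (@nat_of_ord s) hi0) => i vi imin.
exists i; apply/eigenvalueP; exists (submxrow v i) => //.
have := congr1 (fun w => submxrow w i) vA.
rewrite -{1}(submxrowK v) -{1}(submxblockK A) mul_mxrow_mxblock mxrowK.
rewrite (bigD1 i)//= big1 ?addr0 => [->|k].
  by apply/matrixP => ? ?; rewrite !mxE.
rewrite neq_ltn => /orP[ki|ik]; last by rewrite hA// mulmx0.
suff /eqP-> : submxrow v k == 0 by rewrite mul0mx.
by apply: contraTT ki => /imin; rewrite -leqNgt.
Qed.

(* Let [Q] be the projection onto the blocks after [i]. Row vectors supported on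
   these blocks form a subspace stable under [A - l]; if [A - l] is invertible
   it maps this subspace onto itself, so no other row vector is mapped into it. *)
Lemma block_eigenvalue A l i :
    (forall i j : 'I_s, (j < i)%N -> submxblock A i j = 0) ->
  eigenvalue (submxblock A i i) l -> eigenvalue A l.
Proof.
move=> hA /eigenvalueP[w wA w0]; apply: contraT => /negPn/eqP kerA.
set B := A - l%:M.
have Bu : B \in unitmx by rewrite -row_free_unit -kermx_eq0; apply/eqP.
have hB (k j : 'I_s) : (j < k)%N -> submxblock B k j = 0.
  move=> jk; rewrite submxblockB hA// sub0r submxblock_scalar_off ?oppr0//.
  by rewrite neq_ltn jk orbT.
have wB : w *m submxblock B i i = 0.
  rewrite submxblockB mulmxBr wA submxblock_scalar.
  by rewrite mul_mx_scalar subrr.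
pose Q : 'M[F]_D := \mxdiag_j (if (i < j)%N then 1%:M else 0).
have QB : Q *m B = Q *m B *m Q.
  rewrite -[B]submxblockK mul_mxdiag_mxblock mul_mxblock_mxdiag.
  apply: eq_mxblock => k j; case: ifP => ik; last by rewrite !mul0mx.
  case: ifPn => ij; first by rewrite mulmx1.
  by rewrite hB ?mulmx0// (leq_ltn_trans _ ik)// leqNgt.
(* Multiplying by the invertible [B] preserves the rank, so the inclusion of row spaces given by
   [QB] is an equality. *)
have QQB : (Q <= Q *m B)%MS.
  have QBQ : (Q *m B <= Q)%MS by rewrite QB submxMl.
  by rewrite -(geq_leqif (mxrank_leqif_sup QBQ)) mxrankMfree// row_free_unit.
have [Y QY] := submxP QQB.
pose w' := w *m submxcol (1%:M) i.
have w'E j : submxrow w' j = w *m submxblock (1%:M) i j.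
  by rewrite -mul_submxrow -submxblockEv.
have w'Q : w' *m Q = 0.
  apply/mxrowP => j; rewrite -(submxrowK w') mul_mxrow_mxdiag mxrowK submxrow0.
  case: ifPn => ij; last by rewrite mulmx0.
  by rewrite w'E submxblock_scalar_off ?mulmx0 ?mul0mx// neq_ltn ij.
have w'B : w' *m B = w' *m B *m Q.
  apply/mxrowP => j; rewrite -{2}(submxrowK (w' *m B)) mul_mxrow_mxdiag mxrowK.
  case: ifPn => [_|]; first by rewrite mulmx1.
  rewrite -leqNgt mulmx0 -mul_submxrow -mulmxA submxcol_mul mul1mx.
  rewrite -submxblockEh leq_eqVlt => /orP[/eqP/val_inj ->//|ji].
  by rewrite hB// mulmx0.
have QQ : Q *m Q = Q.
  rewrite /Q mul_mxdiag_mxblock; apply: eq_mxblock => k j.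
  case: (eqVneq k j) => [<-|_]; last by rewrite mulmx0.
  by rewrite conform_mx_id; case: ifP => _; rewrite ?mul1mx ?mul0mx.
(* Cancelling [B] puts [w'] in the row space of the idempotent [Q]; as [w' *m Q = 0], this forces
   [w' = 0]. *)
have w'Y : w' = w' *m B *m Y *m Q.
  by apply: (can_inj (mulmxK Bu)); rewrite -!mulmxA -QY !mulmxA -w'B.
have := w'E i; rewrite w'Y -[Q in _ *m Q]QQ !mulmxA -w'Y w'Q submxrow0.
by rewrite submxblock_scalar mulmx1 => w0'; rewrite -w0' eqxx in w0.
Qed.
End BlockTriangular.

(** * Irreducible semigroups of spectral radius at most one are bounded *)

(** In a full-rank factorization of [E], idempotence makes the product of the factors in reverse
    order an identity matrix of size [\rank E]. *)
Lemma idempotent_trace (F : fieldType) n (E : 'M[F]_n) :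
  E *m E = E -> \tr E = (\rank E)%:R.
Proof.
move=> EE; rewrite -{1}(mulmx_base E) mxtrace_mulC.
suff -> : row_base E *m col_base E = 1%:M by rewrite mxtrace1.
apply: (row_free_inj (row_base_free E)); apply: (row_full_inj (col_base_full E)).
by rewrite /= mul1mx mulmx_base -[RHS]EE -[in RHS](mulmx_base E) !mulmxA.
Qed.

Lemma horner_mx_eigenvector (F : fieldType) n (M : 'M[F]_n.+1) (v : 'cV[F]_n.+1)
    (a : F) (p : {poly F}) :
  M *m v = a *: v -> horner_mx M p *m v = p.[a] *: v.
Proof.
move=> Mv; elim/poly_ind: p => [|p c IH]; first by rewrite rmorph0 mul0mx horner0 scale0r.
rewrite rmorphD rmorphM/= horner_mx_X horner_mx_C !hornerE mulmxDl -mulmxE.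
by rewrite -mulmxA Mv -scalemxAr IH mul_scalar_mx scalerA mulrC -scalerDl.
Qed.

(* Project onto the generalized eigenspace of the eigenvalue [1], along the
   other ones: the projection is a polynomial in [M] without constant term, and
   its trace is its rank. *)
Lemma trace_fixed_vector (K : numFieldType) n (M : 'M[K]_n) (v : 'cV[K]_n) :
  v != 0 -> M *m v = v -> exists k, \tr (M ^+ k.+1) != 0.
Proof.
case: n => [|n] in M v *; first by rewrite [v]flatmx0 eqxx.
move=> v0 Mv; apply: contrapT => /forallNP trM.
have {}trM p : \tr (M *m horner_mx M p) = 0.
  (* The left factor is generalized to [M ^+ k.+1], since each factor ['X] of [p] raises the
     exponent by one. *)
  rewrite -[M in X in X *m _]expr1; elim/poly_ind: p 0%N => [|p c IH] k.
    by rewrite rmorph0 mulmx0 mxtrace0.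
  have /negP := trM k; rewrite negbK => /eqP trk.
  rewrite mulrC rmorphD rmorphM/= horner_mx_X horner_mx_C mulmxDr mxtraceD.
  rewrite mul_mx_scalar mxtraceZ trk mulr0 addr0 mulmxE mulrA -exprSr.
  exact: IH.
set chi := char_poly M.
have Mv1 : M *m v = 1 *: v by rewrite scale1r.
have [m [q q1 chiE]] := multiplicity_XsubC chi 1.
have chi0 : chi != 0 by exact: monic_neq0 (char_poly_monic M).
rewrite chi0/= in q1.
have m0 : (0 < m)%N.
  have := horner_mx_eigenvector chi Mv1; rewrite Cayley_Hamilton mul0mx.
  move/esym/eqP; rewrite scaler_eq0 (negPf v0) orbF -[_ == _]/(root chi 1) chiE.
  by case: (m) => //; rewrite expr0 mulr1 (negPf q1).
have : coprimep (q * 'X) (('X - 1%:P) ^+ m).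
  by rewrite coprimep_expr// coprimep_XsubC rootM negb_or q1 rootX oner_eq0.
move=> /Bezout_eq1_coprimepP[[u w] /= uw].
(* By the Bezout identity, the polynomial defining [E] is [1] at [1], so [E] fixes [v], and it is
   idempotent modulo [chi], so [E] is a projection. *)
pose E := M *m horner_mx M (u * q).
have EE' : E = horner_mx M (u * (q * 'X)).
  by rewrite /E -{1}[M]horner_mx_X mulmxE -rmorphM [_ * (u * q)]mulrC -mulrA.
have EE : E *m E = E.
  apply/eqP; rewrite -subr_eq0 EE' mulmxE -rmorphM -rmorphB.
  rewrite (_ : _ - _ = - (u * 'X * w) * chi).
    by rewrite rmorphM/= Cayley_Hamilton mulr0.
  by rewrite -[X in _ - X]mulr1 -uw chiE; ring.
have Ev : E *m v = v.
  rewrite EE' (horner_mx_eigenvector _ Mv1).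
  have /(congr1 (fun p => p.[1])) := uw.
  rewrite hornerD [(w * _).[_]]hornerM horner_exp !hornerE subrr expr0n.
  by rewrite gtn_eqF// mulr0 addr0 => ->; rewrite scale1r.
have /eqP := trM (u * q); rewrite (idempotent_trace EE) pnatr_eq0 mxrank_eq0.
by move=> /eqP E0; move/eqP: v0; apply; rewrite -Ev E0 mul0mx.
Qed.

Lemma span_ind (F : fieldType) (V : vectType F) (X : seq V) (P : V -> Prop) :
    P 0 -> (forall x y, P x -> P y -> P (x + y)) -> (forall a x, P x -> P (a *: x)) ->
    (forall x, x \in X -> P x) ->
  forall x, x \in <<X>>%VS -> P x.
Proof.
move=> P0 PD PZ PX x /(@coord_span _ _ _ (in_tuple X)) ->.
apply: big_ind => // i _; apply/PZ/PX/mem_nth; exact: ltn_ord.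
Qed.

(** Otherwise every free family in [S] could be extended by an element of [S], beyond the dimension
    of the space. *)
Lemma exists_free_span (F : fieldType) (V : vectType F) (S : set V) :
  exists X : seq V, [/\ free X, forall x, x \in X -> S x &
                     forall x, S x -> x \in <<X>>%VS].
Proof.
apply: contrapT => noX.
have H k : exists X : seq V, [/\ size X = k, free X & forall x, x \in X -> S x].
  elim: k => [|k [X [sX fX XS]]].
    by exists [::]; split => //; rewrite nil_free.
  have [x Sx xX] : exists2 x, S x & x \notin <<X>>%VS.
    apply: contrapT => nx; apply: noX; exists X; split=> // x Sx.
    by apply: contrapT => xX; apply: nx; exists x => //; apply/negP.
  exists (x :: X); split; rewrite /= ?sX ?free_cons ?xX//.
  by move=> y; rewrite inE => /predU1P[->//|/XS].
have [X [sX fX _]] := H (\dim {:V}).+1.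
have := dimvS (subvf <<X>>%VS); rewrite -(eqnP fX) in sX *.
by rewrite sX ltnn.
Qed.

Section Irreducible.
Context (R : realType) (n : nat) (S : set 'M[R]_n).
Hypotheses (Ssg : mx_semigroup S) (Sirr : irreducible_mxset S).
Context (X : seq 'M[R]_n).
Hypotheses (XS : forall x, x \in X -> S x) (SX : forall x, S x -> x \in <<X>>%VS).

Lemma span_mulmx A B : A \in <<X>>%VS -> B \in <<X>>%VS -> A *m B \in <<X>>%VS.
Proof.
move=> AX BX; move: A AX.
apply: span_ind => [|x y hx hy|a x hx|x xX]; rewrite ?mul0mx ?mem0v//.
- by rewrite mulmxDl memvD.
- by rewrite -scalemxAl memvZ.
move: B BX; apply: span_ind => [|y z hy hz|a y hy|y yX]; rewrite ?mulmx0 ?mem0v//.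
- by rewrite mulmxDr memvD.
- by rewrite -scalemxAr memvZ.
by apply/SX/Ssg; exact: XS.
Qed.

(** The vectors [B *m v], with [B] in the span, form an invariant subspace. It need not contain [v],
    as the span need not contain the identity; hence the first alternative. *)
Lemma span_orbit (v : 'cV[R]_n) : v != 0 ->
  (forall B, S B -> B *m v = 0) \/
  forall u, exists2 B, B \in <<X>>%VS & B *m v = u.
Proof.
move=> v0; pose f := linfun (mulmxr v : 'M[R]_n -> 'cV[R]_n).
have fE B : f B = B *m v by rewrite lfunE.
have [A SA u|U0|Ufull] := @Sirr (f @: <<X>>)%VS.
- move=> /memv_imgP[B BX ->]; apply/memv_imgP; exists (A *m B).
    by apply: span_mulmx => //; exact: SX.
  by rewrite !fE mulmxA.
- left => B SB; have : f B \in (f @: <<X>>)%VS by apply/memv_img/SX.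
  by rewrite U0 memv0 fE => /eqP.
- right => u; have : u \in (f @: <<X>>)%VS by rewrite Ufull memvf.
  by move=> /memv_imgP[B BX uB]; exists B => //; rewrite -fE.
Qed.

(** If column [j] of [N] is nonzero, some [B] in the span sends it to the basis vector $e_j$. Then
    [B *m N] fixes $e_j$, so one of its powers has nonzero trace; by cyclicity that is the trace of
    [N] times an element of the span. *)
Lemma irreducible_trace_form_nondegenerate N :
  N \in <<X>>%VS -> (forall B, B \in X -> \tr (N *m B) = 0) -> N = 0.
Proof.
move=> NX trN; apply: contrapT => /eqP N0.
have {}trN : forall B, B \in <<X>>%VS -> \tr (N *m B) = 0.
  apply: span_ind => [|x y hx hy|a x hx|//]; first by rewrite mulmx0 mxtrace0.
    by rewrite mulmxDr mxtraceD hx hy addr0.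
  by rewrite -scalemxAr mxtraceZ hx mulr0.
have [j Nj] : exists j, col j N != 0.
  apply/existsP; apply: contraR N0; rewrite negb_exists => /forallP h.
  apply/eqP/matrixP => i j; have := h j; rewrite negbK => /eqP/colP/(_ i).
  by rewrite !mxE.
(* If [S] annihilates the column, the line through it is invariant, hence the whole space, and every
   element of [S] is zero. *)
have [S0|/(_ (delta_mx j 0))[B BX BN]] := span_orbit Nj.
  have [A SA u|/eqP|line] := @Sirr <[col j N]>%VS.
  - by move=> /vlineP[k ->]; rewrite -scalemxAr S0// scaler0 mem0v.
  - by rewrite -subv0 -memvE memv0 (negPf Nj).
  - have SA0 A : S A -> A = 0.
      move=> SA; apply/matrixP => a b.
      have : delta_mx b 0 \in <[col j N]>%VS by rewrite line memvf.
      move=> /vlineP[k /(congr1 (fun w => (A *m w) a 0))].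
      by rewrite -scalemxAr S0// scaler0 -colE !mxE.
    have N0' : N = 0.
      by move: N NX {trN Nj S0 line N0 j}; apply: span_ind => [//|x y -> ->|a x ->|x /XS/SA0//];
        rewrite ?addr0 ?scaler0.
    by rewrite N0' eqxx in N0.
have e0 : delta_mx j 0 != 0 :> 'cV[R]_n.
  by apply/negP => /eqP/colP/(_ j); rewrite !mxE !eqxx => /eqP; rewrite oner_eq0.
have [|k] := @trace_fixed_vector _ _ (B *m N) _ e0; first by rewrite -mulmxA -colE.
have BNB : (B *m N) ^+ k *m B \in <<X>>%VS.
  elim: k => [|k IH]; first by rewrite expr0 mul1mx.
  rewrite exprS -mulmxE -!mulmxA; apply: span_mulmx => //; exact: span_mulmx.
by rewrite exprSr -mulmxE mulmxA mxtrace_mulC trN ?eqxx.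
Qed.

End Irreducible.

(* The matrix of the trace form in a basis [X] of the span, taken inside [S], is
   invertible, so [A] in [S] is recovered linearly from the bounded numbers
   [\tr (A *m X_j)]. *)
Lemma irreducible_bounded (R : realType) n (S : set 'M[R]_n) :
    mx_semigroup S -> irreducible_mxset S ->
    (forall A, S A -> spectral_radius A <= 1) ->
  exists C, forall A, S A -> entry_norm A <= C.
Proof.
move=> Ssg Sirr S1; have [X [Xfree XS SX]] := exists_free_span S.
pose x (i : 'I_(size X)) : 'M[R]_n := X`_i.
have xS i : S (x i) by apply/XS/mem_nth; exact: ltn_ord.
pose G : 'M[R]_(size X) := \matrix_(i, j) \tr (x i *m x j).
have GE (c : 'rV_(size X)) : c *m G = \row_j \tr ((\sum_i c 0 i *: x i) *m x j).
  apply/rowP => j; rewrite !mxE mulmx_suml raddf_sum/=; apply: eq_bigr => i _.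
  by rewrite !mxE -scalemxAl mxtraceZ.
(* A row vector killed by [G] gives a combination of [X] orthogonal to [X], which is zero by
   nondegeneracy; freeness concludes. *)
have Gu : G \in unitmx.
  rewrite unitmxE unitfE; apply/det0P => -[c c0 cG].
  have N0 : \sum_i c 0 i *: x i = 0.
    apply: (irreducible_trace_form_nondegenerate Ssg Sirr XS SX).
      by apply: memv_suml => i _; rewrite memvZ// memv_span// mem_nth.
    move=> B /(nthP 0)[j jX <-].
    by move/rowP/(_ (Ordinal jX)) : cG; rewrite GE !mxE.
  move/negP: c0; apply; apply/eqP/rowP => i; rewrite mxE.
  exact: (elimT (@vector.freeP _ _ _ (in_tuple X)) Xfree (fun i => c 0 i) N0 i).
(* The first factor bounds the row of traces of [A *m x j], which lies in [S]; [invmx G] turns this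
   row into the coordinates of [A]. *)
exists ((\sum_(j < size X) n%:R) * entry_norm (invmx G) * \sum_i entry_norm (x i)).
move=> A SA; pose c := \row_i coord (in_tuple X) i A.
have Ac : A = \sum_i c 0 i *: x i.
  rewrite {1}(@coord_span _ _ _ (in_tuple X) A (SX _ SA)).
  by apply: eq_bigr => i _; rewrite mxE.
have cE : c = (\row_j \tr (A *m x j)) *m invmx G by rewrite {1}Ac -GE mulmxK.
rewrite [in leLHS]Ac; apply: le_trans (entry_norm_sum _) _.
rewrite mulr_sumr; apply: ler_sum => i _; rewrite entry_normZ.
apply: ler_wpM2r; first exact: entry_norm_ge0.
apply: le_trans (le_entry_norm _ _ _) _; rewrite cE.
apply: le_trans (entry_normM _ _) _.
apply: ler_wpM2r; first exact: entry_norm_ge0.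
rewrite /entry_norm big_ord1; apply: ler_sum => j _; rewrite mxE.
by rewrite -[n%:R]mulr1 normr_trace_le// S1//; exact: Ssg.
Qed.

(** * Bounded semigroups *)

Lemma norm_le_entry_norm (R : realType) m n (A : 'M[R]_(m, n)) : `|A| <= entry_norm A.
Proof.
rewrite /Num.norm/= mx_normrE; apply: bigmax_le; first exact: entry_norm_ge0.
by move=> i _; exact: le_entry_norm.
Qed.

Lemma entry_norm_le_norm (R : realType) m n (A : 'M[R]_(m, n)) :
  entry_norm A <= \sum_(i < m) \sum_(j < n) `|A|.
Proof.
apply: ler_sum => i _; apply: ler_sum => j _.
by rewrite {2}/Num.norm/= mx_normrE (le_bigmax _ (fun p => `|A p.1 p.2|) (i, j)).
Qed.

Lemma bounded_set_entry_norm (R : realType) n (S : set 'M[R]_n) :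
  bounded_set S <-> exists C, forall A, S A -> entry_norm A <= C.
Proof.
split=> [|[C SC]].
  (* [bounded_set] bounds the norm by each number above [M], hence [M + 1]. *)
  move=> [M [Mreal SM]]; exists (\sum_(i < n) \sum_(j < n) (M + 1)) => A SA.
  apply: le_trans (entry_norm_le_norm _) _.
  apply: ler_sum => i _; apply: ler_sum => j _.
  by apply: (SM (M + 1)) => //; rewrite ltrDl.
exists C; split; first exact: num_real.
move=> M CM A SA; apply: le_trans (norm_le_entry_norm _) _.
exact: le_trans (SC A SA) (ltW CM).
Qed.

(** By Bernoulli's inequality, in the form $k (a - 1) \le a^k$. *)
Lemma eventually_le_expr (R : realType) (a C : R) : 1 < a ->
  exists k0, forall k, (k0 <= k)%N -> C <= a ^+ k.
Proof.
move=> a1; have ak k : k%:R * (a - 1) <= a ^+ k.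
  elim: k => [|k IH]; first by rewrite mul0r ler01.
  rewrite exprS -natr1.
  have : 1 <= a ^+ k by rewrite exprn_ege1// ltW.
  by nra.
exists (Num.bound `|C / (a - 1)|) => k hk; apply: le_trans (ak k).
rewrite -ler_pdivrMr ?subr_gt0//; apply: le_trans (ler_norm _) _.
apply: le_trans (ltW (archi_boundP (normr_ge0 _))) _.
by rewrite ler_nat.
Qed.

Lemma semigroup_prod (R : realType) n (S : set 'M[R]_n) k (M : 'I_k.+1 -> 'M[R]_n) :
  mx_semigroup S -> (forall i, S (M i)) -> S (\prod_i M i).
Proof.
move=> Ssg; elim: k M => [|k IH] M SM; first by rewrite big_ord1.
by rewrite big_ord_recl; apply: Ssg => //; apply: IH.
Qed.

Lemma semigroupX (R : realType) n (S : set 'M[R]_n) A k :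
  mx_semigroup S -> S A -> (0 < k)%N -> S (A ^+ k).
Proof.
case: k => // k Ssg SA _; elim: k => [|k IH]; first by rewrite expr1.
by rewrite exprS; exact: Ssg.
Qed.

(** The powers of an eigenvalue of modulus above [1] would be unbounded, yet they are eigenvalues of
    the powers of [A]. *)
Lemma spectral_radius_le1 (R : realType) n (A : 'M[R]_n) (C : R) : (0 < n)%N ->
    (forall k, (0 < k)%N -> spectral_radius (A ^+ k) <= C) ->
  spectral_radius A <= 1.
Proof.
move=> n0 AC; apply: spectral_radius_le => // l Al.
rewrite leNgt; apply/negP => l1.
have [k0 hk0] := eventually_le_expr (C + 1) l1.
have := hk0 k0.+1 (leqnSn _); rewrite -normcX leNgt => /negP; apply.
apply: (@le_lt_trans _ _ C); last by rewrite ltrDl.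
apply: le_trans (AC k0.+1 _) => //; apply: spectral_radius_ub.
by rewrite rmorphXn; exact: eigenvalueX.
Qed.

Lemma bounded_semigroup_spectral_radius (R : realType) n (S : set 'M[R]_n) (C : R) :
    (0 < n)%N -> mx_semigroup S -> (forall A, S A -> entry_norm A <= C) ->
  forall A, S A -> spectral_radius A <= 1.
Proof.
move=> n0 Ssg SC A SA; apply: (@spectral_radius_le1 _ _ _ C) => // k k0.
exact: le_trans (spectral_radius_le_entry_norm _ n0) (SC _ (semigroupX Ssg SA k0)).
Qed.

(** All positive powers of an element have radius [r], which excludes [1 < r] by growth, and [r < 1]
    because some power would have norm below [r]. *)
Lemma csr_radius_eq1 (R : realType) n (S : set 'M[R]_n) (r : R) :
    (0 < n)%N -> mx_semigroup S -> S !=set0 -> r != 0 ->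
    (forall A, S A -> spectral_radius A = r) -> r = 1.
Proof.
move=> n0 Ssg [A SA] r0 Sr; apply/eqP; rewrite eq_le; apply/andP; split.
  rewrite -(Sr A SA); apply: (@spectral_radius_le1 _ _ _ r) => // k k0.
  by rewrite Sr//; exact: semigroupX.
rewrite leNgt; apply/negP => r1; rewrite -(Sr A SA) in r1.
have r_gt0 : 0 < r by rewrite lt_def r0 -(Sr A SA) spectral_radius_ge0.
have [k k0] := small_power r1 r_gt0; rewrite ltNge => /negP; apply.
rewrite -{1}(Sr _ (semigroupX Ssg SA k0)).
exact: spectral_radius_le_entry_norm.
Qed.

(** Nonempty products stay in [S], so their norms are at most [C], which $(1 + e)^k$ eventually
    exceeds. *)
Lemma bounded_semigroup_joint_spectral_radius (R : realType) n (S : set 'M[R]_n) (C : R) :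
    mx_semigroup S -> (forall A, S A -> entry_norm A <= C) ->
  joint_spectral_radius S <= 1.
Proof.
move=> Ssg SC; rewrite /joint_spectral_radius; set u := (X in limn X).
(* Without convergence, [limn] takes the default value [0]. *)
have [cu|/dvgP->] := pselect (cvgn u); last exact: ler01.
apply/ler_addgt0Pl => e e0.
have e1 : 1 < e + 1 by rewrite ltrDr.
apply: limr_le => //; have [k0 hk0] := eventually_le_expr C e1.
(* Starting at [k0.+1] excludes [k = 0], where the product is empty and the root is meaningless. *)
exists k0.+1 => // -[//|k] /= kk; rewrite /u.
set E := image _ _; have [E0|/set0P/negP] := pselect (E !=set0); last first.
  by rewrite negbK => /eqP->; rewrite sup0; lra.
apply: ge_sup => // _ [M SM <-].
apply: (@le_trans _ _ (((e + 1) ^+ k.+1) `^ k.+1%:R^-1)).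
  apply: ge0_ler_powR; rewrite ?invr_ge0 ?nnegrE ?exprn_ge0//; first by lra.
  apply: le_trans (norm_le_entry_norm _) _.
  apply: le_trans (hk0 _ (ltnW kk)); apply: SC; exact: semigroup_prod.
rewrite -powR_mulrn -?powRrM ?mulfV ?powRr1//; lra.
Qed.

(** * Diagonal blocks of a semigroup *)

Lemma eigenvalue_conj (F : fieldType) n (P A : 'M[F]_n) (l : F) :
  P \in unitmx -> eigenvalue (invmx P *m A *m P) l = eigenvalue A l.
Proof.
move=> Pu; apply/idP/idP => /eigenvalueP[v vA v0]; apply/eigenvalueP.
  exists (v *m invmx P).
    by rewrite scalemxAl -vA !mulmxA mulmxK.
  by apply: contraNneq v0 => vP; rewrite -[v](mulmxKV Pu) vP mul0mx.
exists (v *m P); first by rewrite !mulmxA mulmxK// vA scalemxAl.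
by apply: contraNneq v0 => vP; rewrite -[v](mulmxK Pu) vP mul0mx.
Qed.

Section BlockSpectrum.
Context (R : realType) (s : nat) (d : 'I_s -> nat).
Local Notation D := (\sum_(i < s) d i)%N.
Context (P : 'M[R]_D).
Hypothesis hP : P \in unitmx.

Lemma map_submxblock (A : 'M[R]_D) i j :
  complex_mx R (submxblock A i j) = submxblock (complex_mx R A) i j.
Proof. by apply/matrixP => k l; rewrite !mxE. Qed.

Lemma in_basisM (A B : 'M[R]_D) : in_basis P (A *m B) = in_basis P A *m in_basis P B.
Proof. by rewrite /in_basis !mulmxA mulmxK. Qed.

Lemma eigenvalue_in_basis (A : 'M[R]_D) l :
  eigenvalue (complex_mx R (in_basis P A)) l = eigenvalue (complex_mx R A) l.
Proof. by rewrite /in_basis !map_mxM map_invmx eigenvalue_conj// map_unitmx. Qed.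

Lemma complex_block_triangular (A : 'M[R]_D) : block_upper_triangular A ->
  forall i j : 'I_s, (j < i)%N -> submxblock (complex_mx R A) i j = 0.
Proof. by move=> hA i j ij; rewrite -map_submxblock hA// map_mx0. Qed.

Lemma spectral_radius_block (A : 'M[R]_D) i : (0 < d i)%N ->
  block_upper_triangular (in_basis P A) ->
  spectral_radius (submxblock (in_basis P A) i i) <= spectral_radius A.
Proof.
move=> di hA; apply: spectral_radius_le => // l.
rewrite map_submxblock => /(block_eigenvalue (complex_block_triangular hA)).
by rewrite eigenvalue_in_basis; exact: spectral_radius_ub.
Qed.

Lemma spectral_radius_le_blocks (A : 'M[R]_D) (r : R) : (0 < D)%N ->
    block_upper_triangular (in_basis P A) ->
    (forall i, spectral_radius (submxblock (in_basis P A) i i) <= r) ->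
  spectral_radius A <= r.
Proof.
move=> D0 hA Ar; apply: spectral_radius_le => // l; rewrite -eigenvalue_in_basis.
move=> Al; have [i Ail] := eigenvalue_block (complex_block_triangular hA) Al.
by apply: le_trans (Ar i); apply: spectral_radius_ub; rewrite map_submxblock.
Qed.

Context (S : set 'M[R]_D).
Hypothesis hblock : forall A, S A -> block_upper_triangular (in_basis P A).
Hypothesis Ssg : mx_semigroup S.

Lemma diag_blockM A B i : S A -> S B ->
  submxblock (in_basis P (A *m B)) i i =
  submxblock (in_basis P A) i i *m submxblock (in_basis P B) i i.
Proof. by move=> SA SB; rewrite in_basisM submxblockM_diag//; exact: hblock. Qed.

Lemma diag_blockX A k i : S A -> (0 < k)%N ->
  submxblock (in_basis P (A ^+ k)) i i = submxblock (in_basis P A) i i ^+ k.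
Proof.
move=> SA; case: k => // k _; elim: k => [|k IH]; first by rewrite !expr1.
by rewrite !(exprS _ k.+1) -!mulmxE diag_blockM ?IH//; exact: semigroupX.
Qed.

Lemma diag_block_semigroup i : mx_semigroup (diag_block_set P S i).
Proof.
move=> _ _ [A SA <-] [B SB <-]; exists (A *m B); first exact: Ssg.
exact: diag_blockM.
Qed.

(* A high power of an element whose [j]-th block has spectral radius below [1]
   makes the [j]-th block small, and multiplying by it enlarges the other blocks
   at most by the common bound [K]. *)
Lemma small_diag_blocks (K : R) : S !=set0 ->
    (forall i A, S A -> entry_norm (submxblock (in_basis P A) i i) <= K) ->
    (forall i, exists2 A, S A & spectral_radius (submxblock (in_basis P A) i i) < 1) ->
  forall e, 0 < e ->
  exists2 A, S A & forall i, entry_norm (submxblock (in_basis P A) i i) < e.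
Proof.
move=> S0 SK S1.
(* Induction on the list of blocks made small so far, with [e] varying: the blocks in the tail must
   be below [e / (K + 1)] to absorb a factor [K]. *)
suff H (L : seq 'I_s) e : 0 < e -> exists2 A, S A &
    forall i, i \in L -> entry_norm (submxblock (in_basis P A) i i) < e.
  by move=> e /(H (enum 'I_s))[A SA hA]; exists A => // i; rewrite hA// mem_enum.
elim: L e => [|j L IH] e e0; first by have [A SA] := S0; exists A.
have K0 : 0 <= K by have [A SA] := S0; exact: le_trans (entry_norm_ge0 _) (SK j A SA).
have eK : 0 < e / (K + 1) by rewrite divr_gt0// ltr_wpDl.
have eKK : e / (K + 1) * K < e.
  by rewrite mulrAC ltr_pdivrMr ?ltr_wpDl// ltr_pM2l// ltrDl.
have [B SB hB] := IH _ eK.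
have [A SA A1] := S1 j; have [k k0 hk] := small_power A1 eK.
have SAk := semigroupX Ssg SA k0.
exists (A ^+ k *m B); first exact: Ssg.
move=> i; rewrite diag_blockM// inE => ijL; apply: le_lt_trans eKK.
apply: le_trans (entry_normM _ _) _.
have [ij|ij] := eqVneq i j.
  by subst i; apply: ler_pM; rewrite ?entry_norm_ge0 ?SK// diag_blockX// ltW.
rewrite mulrC; apply: ler_pM; rewrite ?entry_norm_ge0 ?SK// ltW// hB//.
by case/predU1P: ijL ij => [->|//]; rewrite eqxx.
Qed.
End BlockSpectrum.

(** * Constant spectral radius in terms of the diagonal blocks *)

Theorem theorem1 (R : realType) (s : nat) (d : 'I_s -> nat)
    (S : set 'M[R]_(\sum_(i < s) d i)) (P : 'M[R]_(\sum_(i < s) d i))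
    (hs : (0 < s)%N)
    (hd : forall i, (0 < d i)%N)
    (hSclosed : closed S)
    (hSsemigroup : mx_semigroup S)
    (hP : P \in unitmx)
    (hblock : forall A, S A -> block_upper_triangular (in_basis P A))
    (hirr : forall i, irreducible_mxset (diag_block_set P S i)) :
  csr S <->
  exists j : 'I_s, csr (diag_block_set P S j) /\
    forall i : 'I_s, i != j ->
      bounded_set (diag_block_set P S i) /\
      joint_spectral_radius (diag_block_set P S i) <= 1.
Proof.
have blocksg := diag_block_semigroup hP hblock hSsemigroup.
have D0 : (0 < \sum_(i < s) d i)%N.
  by rewrite (bigD1 (Ordinal hs))//= addn_gt0 hd.
(* For empty [S] both sides hold vacuously, with common radius [1]. *)
have [S0|noS] := pselect (S !=set0); last first.
  have noblock i A : ~ diag_block_set P S i A by move=> [B SB]; case: noS; exists B.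
  split=> _; last by exists 1; [exact: oner_neq0 | move=> A SA; case: noS; exists A].
  exists (Ordinal hs); split.
    by exists 1; [exact: oner_neq0 | move=> A /noblock].
  have hC i A : diag_block_set P S i A -> entry_norm A <= 0 by move=> /noblock.
  move=> i _; split; first by apply/bounded_set_entry_norm; exists 0; exact: hC.
  exact: bounded_semigroup_joint_spectral_radius (blocksg i) (hC i).
have block0 i : diag_block_set P S i !=set0.
  by have [A SA] := S0; exists (submxblock (in_basis P A) i i), A.
split=> [[r r0 Sr]|[j [[r r0 jr] ij]]]; last first.
  have r1 : r = 1 := csr_radius_eq1 (hd j) (blocksg j) (block0 j) r0 jr.
  exists 1; first exact: oner_neq0.
  move=> A SA; have bA i : diag_block_set P S i (submxblock (in_basis P A) i i) by exists A.
  (* All blocks have radius at most [1], and the block [j] attains it. *)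
  apply/eqP; rewrite eq_le; apply/andP; split.
    apply: (spectral_radius_le_blocks hP D0 (hblock _ SA)) => i.
    have [->|/ij[/bounded_set_entry_norm[C hC] _]] := eqVneq i j; first by rewrite jr ?r1.
    exact: (bounded_semigroup_spectral_radius (hd i) (blocksg i) hC).
  by rewrite -r1 -(jr _ (bA j)); apply: spectral_radius_block => //; exact: hblock.
have r1 : r = 1 := csr_radius_eq1 D0 hSsemigroup S0 r0 Sr.
have block1 i A : diag_block_set P S i A -> spectral_radius A <= 1.
  by move=> [B SB <-]; rewrite -r1 -(Sr B SB); apply: spectral_radius_block => //; exact: hblock.
have bounded i := irreducible_bounded (blocksg i) (@hirr i) (block1 i).
have [C hC] := choice bounded.
have [j jcsr] : exists j, forall A, S A -> 1 <= spectral_radius (submxblock (in_basis P A) j j).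
  apply: contrapT => noj.
  (* The sum bounds all blocks at once; [1 / 2] serves as a positive number below the common radius
     [1]. *)
  have [i A SA|i||A SA hA] := @small_diag_blocks R s d P hP S hblock hSsemigroup
    (\sum_i `|C i|) S0 _ _ (1 / 2).
  - have := hC i _ (ex_intro2 _ _ A SA erefl) => /le_trans; apply.
    by apply: le_trans (ler_norm _) _; rewrite (bigD1 i)//= lerDl; exact: sumr_ge0.
  - apply: contrapT => noA; apply: noj; exists i => A SA; rewrite leNgt; apply/negP => A1.
    by apply: noA; exists A.
  - by rewrite divr_gt0.
  - have : spectral_radius A <= 1 / 2.
      apply: (spectral_radius_le_blocks hP D0 (hblock _ SA)) => i.
      exact: le_trans (spectral_radius_le_entry_norm _ (hd i)) (ltW (hA i)).
    by rewrite Sr// r1; lra.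
exists j; split.
  exists 1; first exact: oner_neq0.
  move=> _ [A SA <-]; apply/eqP; rewrite eq_le jcsr// andbT.
  by apply: (block1 j); exists A.
move=> i _; split; first by apply/bounded_set_entry_norm; exact: bounded.
exact: bounded_semigroup_joint_spectral_radius (blocksg i) (hC i).
Qed.
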